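(* Let $\kappa$ be a measurable cardinal, and let $p,q$ be two properties of ordinals that are separable for $\kappa$ and are above measurability, i.e. the sets $A_p=\{\alpha<\kappa:p(\alpha)\}$ and $A_q=\{\alpha<\kappa:q(\alpha)\}$ consist of measurable cardinals. For every measurable cardinal $\alpha<\kappa$ let $U_\alpha$ be a normal ultrafilter on $\alpha$ such that $\{\beta<\alpha:\beta\text{ is a measurable cardinal}\}\notin U_\alpha$. For every $X\subseteq\kappa$ let $S_X=\{\alpha<\kappa:\alpha\text{ is measurable and }X\cap\alpha\in U_\alpha\}$. If there is $X\subseteq\kappa$ such that $S_X=A_p\setminus A_q$, then there are at least two distinct normal ultrafilters on $\kappa$ which do not contain the set $\{\alpha<\kappa:\alpha\text{ is a measurable cardinal}\}$.
   Context: Work in ZFC. A measurable cardinal is an uncountable cardinal $\kappa$ carrying a $\kappa$-complete non-principal ultrafilter. A normal ultrafilter on $\kappa$ is a $\kappa$-complete non-principal ultrafilter on $\kappa$ such that every regressive function on a set in the ultrafilter is constant on a set in the ultrafilter. Properties $p$ and $q$ (in this order) are separable for $\kappa$ if there is a normal ultrafilter $U$ on $\kappa$ with $A_p\in U$ and $A_q\in U$, and there is also a normal ultrafilter $W$ on $\kappa$ with $A_p\in W$ and $A_q\notin W$. *)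

(* Defs.v *)
From HB Require Import structures.
From mathcomp Require Import all_boot all_order.
From mathcomp Require Import boolp classical_sets functions cardinality filter.
From mathcomp Require wochoice.

Set Implicit Arguments.
Unset Strict Implicit.
Unset Printing Implicit Defensive.

Import Order.TTheory.

Local Open Scope classical_set_scope.
Local Open Scope card_scope.
Local Open Scope order_scope.

(** An ordinal is represented by a well-ordered type [T]. An ordinal below [T]
    is an element [a : T]; as a well-ordered type it is its initial segment
    [below a], in accordance with [a = {b | b < a}]. *)

Section Below.
Context {d : Order.disp_t} {T : orderType d}.

Definition below (a : T) : Type := {b : T | b < a}.

HB.instance Definition _ (a : T) := SubChoice.on (below a).
HB.instance Definition _ (a : T) :=
  [SubChoice_isSubOrder of below a by <: with d].

End Below.

Definition is_ordinal {d : Order.disp_t} (T : orderType d) : Prop :=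
  wochoice.well_order (<=%O : rel T).

(** Cardinals are initial ordinals. Since [below a] embeds into [T], the second
    clause says that [below a] has strictly smaller cardinality than [T]. *)
Definition is_cardinal {d : Order.disp_t} (T : orderType d) : Prop :=
  is_ordinal T /\ forall a : T, ~ ([set: T] #<= [set: below a]).

(** Closure under intersections of fewer than [|T|] members. *)
Definition kappa_complete {T : Type} (U : set_system T) : Prop :=
  forall G : set_system T, G `<=` U ->
    G #<= [set: T] -> ~ ([set: T] #<= G) -> U (\bigcap_(A in G) A).

Definition complete_nonprincipal_ultrafilter {T : Type} (U : set_system T) :
    Prop :=
  [/\ UltraFilter U, kappa_complete U
    & forall x : T, U <> principal_filter x].

Definition measurable_cardinal {d : Order.disp_t} (T : orderType d) : Prop :=
  [/\ is_cardinal T, ~ countable [set: T]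
    & exists U : set_system T, complete_nonprincipal_ultrafilter U].

(** A regressive function on [A] is given by a total [f : T -> T] of which only
    the values on [A] matter. *)
Definition normal_ultrafilter {d : Order.disp_t} {T : orderType d}
    (U : set_system T) : Prop :=
  complete_nonprincipal_ultrafilter U /\
  forall (A : set T) (f : T -> T),
    U A -> (forall x, A x -> f x < x) ->
    exists (B : set T) (c : T), [/\ U B, B `<=` A & forall x, B x -> f x = c].

Definition measurables {d : Order.disp_t} (T : orderType d) : set T :=
  [set a : T | measurable_cardinal (below a)].
Arguments measurables {d} T.

(** [a] viewed as a subset of [T] is [[set b | b < a]]; this is the set
    [X `&` a], as a subset of [below a]. *)
Definition trace {d : Order.disp_t} {T : orderType d} (X : set T) (a : T) :
    set (below a) :=
  [set b : below a | X (val b)].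
Arguments trace {d T} X a.

Definition separable {d : Order.disp_t} {T : orderType d} (p q : T -> Prop) :
    Prop :=
  (exists U : set_system T,
     [/\ normal_ultrafilter U, U [set a | p a] & U [set a | q a]]) /\
  (exists W : set_system T,
     [/\ normal_ultrafilter W, W [set a | p a] & ~ W [set a | q a]]).

Definition above_measurability {d : Order.disp_t} {T : orderType d}
    (p : T -> Prop) : Prop :=
  [set a | p a] `<=` measurables T.

(** [U] assigns a family to every [a < T]; only its values at measurable [a]
    are used. *)
Definition S_set {d : Order.disp_t} {T : orderType d}
    (U : forall a : T, set_system (below a)) (X : set T) : set T :=
  [set a : T | measurable_cardinal (below a) /\ U a (trace X a)].

(* Main.v *)
Require Import Defs.
From mathcomp Require Import all_boot all_order.
From mathcomp Require Import boolp classical_sets functions cardinality filter.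

(** The two ultrafilters are ultrafilter limits of the given family. If [D] is
    a normal ultrafilter on [K] concentrating on measurables, let [X] be large
    when [X `&` a] belongs to [U a] for [D]-almost every [a], i.e. when
    [D (S_set U X)] ([limit_filter]). Each property of an ultrafilter on [K] is
    obtained for the limit by using it for [U a] at almost every [a] and then
    for [D]:
    - completeness: fewer than [|K|] sets are at most [|below b|] sets for some
      [b] ([card_lt_below], a consequence of the regularity of [K]), which is
      fewer than [|below a|] for almost every [a], namely for [b < a]
      ([tail_in_ultrafilter]);
    - normality: a regressive [f] takes a constant value [c a < a] on a set in
      [U a]; as [c] is itself regressive, it is constant on a set in [D].
    The limit omits the set of measurables, because every [U a] omits its trace.

    Apply this to the normal ultrafilters [D] and [E] witnessing separability:
    [D] contains both [A_p] and [A_q], and [E] contains [A_p] but not [A_q].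
    Both concentrate on measurables because [A_p] consists of them. The set
    [A_p `\` A_q] is in [E] but not in [D]; since it is [S_set U X], the set
    [X] is in the limit along [E] but not in the limit along [D]. *)

Set Implicit Arguments.
Unset Strict Implicit.
Unset Printing Implicit Defensive.

Import Order.TTheory.

Local Open Scope classical_set_scope.
Local Open Scope card_scope.

(** * Complete ultrafilters *)

Lemma card_le_injective (A B : Type) (f : A -> B) :
  injective f -> [set: A] #<= [set: B].
Proof.
move=> finj; have /card_eqPle[_ +] : f @` setT #= [set: A].
  by apply: inj_card_eq => x y _ _; exact: finj.
by move=> /card_le_trans; apply; exact: card_leT.
Qed.

Lemma complete_bigcap (T J : Type) (U : set_system T) (I : set J)
    (F : J -> set T) :
  kappa_complete U -> I #<= [set: T] -> ~ ([set: T] #<= I) ->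
  (forall i, I i -> U (F i)) -> U (\bigcap_(i in I) F i).
Proof.
move=> Uc IT TI UF.
have := @bigcap_image _ _ _ I F id => /= <-; apply: Uc => [_ [i Ii <-]||TF].
- exact: UF.
- exact: card_le_trans (card_image_le _ _) IT.
- exact: TI (card_le_trans TF (card_image_le _ _)).
Qed.

Lemma dichotomy_ultrafilter (T : Type) (U : set_system T) :
  Filter U -> ~ U set0 -> (forall A, U A \/ U (~` A)) -> UltraFilter U.
Proof.
move=> UF U0 UC; split=> // G GF UG; apply/seteqP; split=> // A GA.
have [//|/UG GnA] := UC A; exfalso; apply: (@filter_not_empty _ G).
by rewrite -(setICr A); exact: filterI.
Qed.

Lemma singletonC_in_ultrafilter (T : Type) (U : set_system T) (x : T) :
  complete_nonprincipal_ultrafilter U -> U (~` [set x]).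
Proof.
move=> [Uu _ Unp]; have [Ux|//] := in_ultra_setVsetC [set x] Uu.
have /Unp[] : U = principal_filter x.
apply: (@max_filter _ (principal_filter x) (principal_filter_ultra x)).
by move=> A /principal_filterP Ax; apply: filterS Ux => _ ->.
Qed.

(** * Cardinals and initial segments *)

Section Segments.
Local Open Scope order_scope.
Context {d : Order.disp_t} {T : orderType d}.

Lemma below_card_le (a : T) : [set: below a] #<= [set: T].
Proof. exact: card_le_injective (@val_inj _ _ (below a)). Qed.

Lemma below_card_mono (a b : T) : a <= b -> [set: below a] #<= [set: below b].
Proof.
move=> ab.
pose f (x : below a) : below b :=
  exist _ (val x) (lt_le_trans (valP x) ab).
by apply: (@card_le_injective _ _ f) => x y /(congr1 val) /= /val_inj.
Qed.

Lemma below_card_lt (a b : T) : is_cardinal (below b) -> a < b ->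
  ~ ([set: below b] #<= [set: below a]).
Proof.
move=> [_ bcard] ab ba; pose a' : below b := exist _ a ab.
(* [below a] and [below a'] are one segment, seen in [T] and in [below b]. *)
pose f (x : below a) : below a' :=
  exist _ (exist _ (val x) (lt_trans (valP x) ab)) (valP x).
apply: (bcard a'); apply: card_le_trans ba _.
apply: (@card_le_injective _ _ f) => x y.
by move=> /(congr1 (fun z => val (val z))) /= /val_inj.
Qed.

Variable U : set_system T.
Hypotheses (Tcard : is_cardinal T) (Uu : complete_nonprincipal_ultrafilter U).

(** The complement of the tail consists of [a] and of the points below [a],
    which are fewer than [|T|] because [T] is an initial ordinal; no singleton
    is in [U], so by completeness the complement is not either. *)
Lemma tail_in_ultrafilter (a : T) : U [set b | a < b].
Proof.
have [Uf Uc _] := Uu.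
have below_large : U (\bigcap_(x in [set: below a]) ~` [set val x]).
  apply: complete_bigcap => //; first exact: below_card_le.
    exact: Tcard.2.
  by move=> x _; exact: singletonC_in_ultrafilter.
apply: filterS (filterI below_large (singletonC_in_ultrafilter a Uu)).
move=> b [/= bN ba]; case: ltgtP => //; last by move=> /esym/ba.
by move=> b_lt_a; case: (bN (exist _ b b_lt_a) I).
Qed.

(** The cardinal [T] is regular: fewer than [|T|] tails have a common element
    because their intersection is in [U], hence a small set of points of [T]
    lies in some initial segment. *)
Lemma card_lt_below (J : Type) : [set: J] #<= [set: T] ->
  ~ ([set: T] #<= [set: J]) -> exists a : T, [set: J] #<= [set: below a].
Proof.
move=> JT TJ; have [Uf Uc _] := Uu.
move: (JT) => /card_leP/unsquash h.
pose pt (j : J) : T := val (h (SigSub (mem_set (I : [set: J] j)))).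
have pt_inj : injective pt.
  move=> i j /val_inj /(inj (mem_set I) (mem_set I)).
  by move=> /(congr1 val).
have /filter_ex[a pt_lt] : U (\bigcap_(j in [set: J]) [set b | pt j < b]).
  by apply: complete_bigcap => // j _; exact: tail_in_ultrafilter.
pose g (j : J) : below a := exist _ (pt j) (pt_lt j I).
exists a; apply: (@card_le_injective _ _ g) => i j.
by move=> /(congr1 val) /= /pt_inj.
Qed.

End Segments.

(** * Limits of normal ultrafilters *)

Definition limit_filter {d : Order.disp_t} {T : orderType d}
    (D : set_system T) (U : forall a : T, set_system (below a)) :
    set_system T :=
  [set X | D (S_set U X)].

Section Limit.
Local Open Scope order_scope.
Context {d : Order.disp_t} {K : orderType d}.
Variables (D : set_system K) (U : forall a : K, set_system (below a)).
Arguments U a : clear implicits.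
Hypothesis Kcard : is_cardinal K.
Hypothesis Dnormal : normal_ultrafilter D.
Hypothesis Dmeas : D (measurables K).
Hypothesis Unormal : forall a : K, measurable_cardinal (below a) ->
  normal_ultrafilter (U a).

Let V := limit_filter D U.

Local Instance D_ultra : UltraFilter D. Proof. by case: Dnormal.1. Qed.

Let U_ultra (a : K) : measurable_cardinal (below a) -> UltraFilter (U a).
Proof. by move=> /Unormal[[]]. Qed.

Lemma S_setS (X Y : set K) : X `<=` Y -> S_set U X `<=` S_set U Y.
Proof.
move=> XY a [am UX]; split=> //; have Ua := U_ultra am.
by apply: filterS UX => b; exact: XY.
Qed.

Lemma limit_ultrafilter : UltraFilter V.
Proof.
apply: dichotomy_ultrafilter.
- split.
  + apply: (@filterS _ D) Dmeas => a am; split=> //; have Ua := U_ultra am.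
    exact: filterT.
  + move=> X Y VX VY; apply: (@filterS _ D) (filterI (VX : D _) (VY : D _)).
    move=> a [[am UX] [_ UY]]; split=> //; have Ua := U_ultra am.
    exact: filterI.
  + by move=> X Y XY; apply: (@filterS _ D); exact: S_setS.
- move=> /(@filter_ex _ D)[a [am]]; have Ua := U_ultra am.
  exact: filter_not_empty.
- move=> X; have [|SXC] := in_ultra_setVsetC (S_set U X) D_ultra; first by left.
  right; apply: (@filterS _ D) (filterI Dmeas SXC) => a [am nUX]; split=> //.
  by have [UX|//] := in_ultra_setVsetC (trace X a) (U_ultra am); case: nUX.
Qed.

(** The completeness of [U a] covers families of fewer than [|below a|] sets,
    so a family [G] must first be bounded by one [below b]; then only the [a]
    above [b] are used, and these are almost all. *)
Lemma limit_complete : kappa_complete V.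
Proof.
move=> G GV GK KG; have [_ Dc _] := Dnormal.1.
have /card_eqPle[GtoS StoG] := card_setT G.
have [b Gb] : exists b : K, [set: G] #<= [set: below b].
  apply: (card_lt_below Kcard Dnormal.1).
    exact: card_le_trans GtoS GK.
  by move=> KG'; exact: KG (card_le_trans KG' GtoS).
have DG : D (\bigcap_(A in G) S_set U A) by exact: complete_bigcap.
have Dtail := tail_in_ultrafilter Kcard Dnormal.1 b.
apply: (@filterS _ D) (filterI Dmeas (filterI Dtail DG)).
move=> a [am [/= b_lt_a UG]]; split=> //.
have [[_ Uc _] _] := Unormal am.
apply: (@complete_bigcap _ _ _ G (fun A => trace A a) Uc) => [||A GA].
- apply: card_le_trans (below_card_mono (ltW b_lt_a)).
  exact: card_le_trans Gb.
- move=> aG; have [acard _ _] := am; apply: (below_card_lt acard b_lt_a).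
  by apply: card_le_trans Gb; exact: card_le_trans aG StoG.
- by have [] := UG A GA.
Qed.

Lemma limit_nonprincipal (x : K) : V <> principal_filter x.
Proof.
move=> Vx; have : V [set x] by rewrite Vx; exact/principal_filterP.
move=> /(@filter_ex _ D)[a [am Uax]]; have Ua := U_ultra am.
(* A set in [U a] is nonempty, so [x < a], and [U a] would contain [x] as a
   singleton. *)
have /filter_ex[y /= yx] := Uax.
have := singletonC_in_ultrafilter y (Unormal am).1.
move=> /(filterI Uax)/filter_ex[z [/= zx]]; apply.
by apply: val_inj; rewrite zx yx.
Qed.

(** The value [c] comes from the normality of [U a] on [below a]. It is returned
    as an element of [K] below [a] so that its choice for each [a] is a
    regressive function on [K], to which the normality of [D] applies. *)
Lemma S_set_regressive (A : set K) (f : K -> K) (a : K) :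
  (forall x, A x -> f x < x) -> S_set U A a ->
  exists2 c : K, c < a & U a (trace [set x | A x /\ f x = c] a).
Proof.
move=> freg [am UA]; have [_ Un] := Unormal am; have Ua := U_ultra am.
pose g (x : below a) : below a := insubd x (f (val x)).
have gE x : A (val x) -> val (g x) = f (val x).
  move=> Ax; rewrite /g val_insubd ifT //.
  exact: lt_trans (freg _ Ax) (valP x).
have [B [c [UB BA Bc]]] : exists B c,
    [/\ U a B, B `<=` trace A a & forall x, B x -> g x = c].
  by apply: Un => // x Ax; rewrite -lt_val gE //; exact: freg.
exists (val c); first exact: (valP c).
apply: filterS UB => x Bx; split; first exact: BA.
by rewrite -(Bc _ Bx) gE //; exact: BA.
Qed.

Lemma limit_normal : normal_ultrafilter V.
Proof.
split.
  split; [exact: limit_ultrafilter|exact: limit_complete|].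
  exact: limit_nonprincipal.
move=> A f VA freg.
have /choice[c cP] : forall a, exists c : K, S_set U A a ->
    c < a /\ U a (trace [set x | A x /\ f x = c] a).
  move=> a; have [Sa|nSa] := pselect (S_set U A a); last by exists a.
  by have [c ca Uc] := S_set_regressive freg Sa; exists c.
have [B [c0 [DB BS Bc]]] : exists B c0,
    [/\ D B, B `<=` S_set U A & forall a, B a -> c a = c0].
  by apply: Dnormal.2 => // a /cP[].
exists [set x | A x /\ f x = c0], c0; split=> [|x []//|x []//].
apply: (@filterS _ D) DB => a Ba; split; first by have [] := BS a Ba.
by rewrite -(Bc a Ba); have [] := cP a (BS a Ba).
Qed.

Lemma limit_not_measurables :
  (forall a, measurable_cardinal (below a) ->
    ~ U a (trace (measurables K) a)) ->
  ~ V (measurables K).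
Proof. by move=> UN /(@filter_ex _ D)[a [am]]; exact: UN. Qed.

End Limit.

(** * Two normal ultrafilters omitting the measurables *)

Theorem theorem3p1 (d : Order.disp_t) (K : orderType d)
  (hK : measurable_cardinal K)
  (p q : K -> Prop)
  (hsep : separable p q)
  (hp : above_measurability p)
  (hq : above_measurability q)
  (U : forall a : K, set_system (below a))
  (hU : forall a : K, measurable_cardinal (below a) ->
     normal_ultrafilter (U a) /\ ~ U a (trace (measurables K) a))
  (hX : exists X : set K, S_set U X = [set a | p a] `\` [set a | q a]) :
  exists V W : set_system K,
    [/\ V <> W,
        normal_ultrafilter V,
        normal_ultrafilter W,
        ~ V (measurables K)
      & ~ W (measurables K)].
Proof.
have [Kcard _ _] := hK; have [X SX] := hX.
have [[D [Dn Dp Dq]] [E [En Ep Eq]]] := hsep.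
have [[Du _ _] _] := Dn; have [[Eu _ _] _] := En.
have Dm : D (measurables K) by exact: filterS Dp.
have Em : E (measurables K) by exact: filterS Ep.
have Un a (am : measurable_cardinal (below a)) := (hU a am).1.
have UN a (am : measurable_cardinal (below a)) := (hU a am).2.
exists (limit_filter D U), (limit_filter E U); split.
- have EX : limit_filter E U X.
    rewrite /limit_filter /= SX; apply: filterI => //.
    by have [/Eq|] := in_ultra_setVsetC [set a | q a] Eu.
  move=> DE; move: EX; rewrite -DE /limit_filter /= SX => DX.
  have DpqDq : D (([set a | p a] `\` [set a | q a]) `&` [set a | q a]).
    exact: filterI.
  by have /filter_ex[a [[_ nqa] /nqa]] := DpqDq.
- exact: limit_normal.
- exact: limit_normal.
- exact: limit_not_measurables.
- exact: limit_not_measurables.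
Qed.
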